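(* Let $1<p<\infty$, $p'=p/(p-1)$, and let $K(dx,dy)$ be a nonnegative Borel measure on $\mathbb{R}^n\times\mathbb{R}^n$, locally finite outside the diagonal $\{x=y\}$, such that: (i) $K(E,F)=K(F,E)$ for all Borel sets $E,F\subset\mathbb{R}^n$; (ii) $\iint_{E\times E}|x-y|^2K(dx,dy)<\infty$ for every compact $E\subset\mathbb{R}^n$; (iii) $\int_{|x|<R}\int_{|y-x|>2R}K(dx,dy)<\infty$ for every $R>0$; and such that for every $u\in C_0^1(\mathbb{R}^n)$ the principal value integral $$Tu(E)=\int_E\int^*_{\mathbb{R}^n}[u(x)-u(y)]\,K(dx,dy)=\lim_{\varepsilon\to0^+}\int_E\int_{\mathbb{R}^n\setminus B_\varepsilon(x)}[u(x)-u(y)]\,K(dx,dy),\qquad E\subset\mathbb{R}^n\text{ Borel},$$ exists. Then the operator $T$ is $L^p$-positive. More precisely, for every $u\in C_0^1(\mathbb{R}^n)$, $$\int_{\mathbb{R}^n}\langle Tu,|u|^{p-2}u\rangle\ \ge\ \frac{2}{p\,p'}\iint_{\mathbb{R}^n\times\mathbb{R}^n}\left(|u(y)|^{p/2}-|u(x)|^{p/2}\right)^2K(dx,dy)\qquad\text{if }p\ge2,$$ $$\int_{\mathbb{R}^n}\langle T(|u|^{p'-2}u),u\rangle\ \ge\ \frac{2}{p\,p'}\iint_{\mathbb{R}^n\times\mathbb{R}^n}\left(|u(y)|^{p'/2}-|u(x)|^{p'/2}\right)^2K(dx,dy)\qquad\text{if }1<p<2.$$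
   Context: $C_0^1(\mathbb{R}^n)$ is the space of real-valued compactly supported $C^1$ functions. $K(E,F)$ means $K(E\times F)$. $B_\varepsilon(x)$ is the ball of radius $\varepsilon$ centred at $x$. $Tu$ is a set function (measure) on $\mathbb{R}^n$, and $\int_{\mathbb{R}^n}\langle Tu,v\rangle$ denotes the integral of $v$ with respect to $Tu$, i.e. $\lim_{\varepsilon\to0^+}\iint_{|x-y|\ge\varepsilon}[u(x)-u(y)]\,v(x)\,K(dx,dy)$. $T$ is called $L^p$-positive if for all $u\in C_0^1(\mathbb{R}^n)$: $\int_{\mathbb{R}^n}\langle Tu,|u|^{p-2}u\rangle\ge0$ when $p\ge2$, and $\int_{\mathbb{R}^n}\langle T(|u|^{p'-2}u),u\rangle\ge0$ when $1<p<2$. (Note $|u|^{q-2}u\in C_0^1(\mathbb{R}^n)$ for $q\ge2$.) *)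

(* Defs.v *)
From HB Require Import structures.
From mathcomp Require Import all_boot all_order all_algebra.
From mathcomp Require Import all_classical all_reals all_analysis.
Set Implicit Arguments.
Unset Strict Implicit.
Unset Printing Implicit Defensive.
Import Order.TTheory GRing.Theory Num.Theory.
Import numFieldTopology.Exports numFieldNormedType.Exports.

Local Open Scope classical_set_scope.
Local Open Scope ring_scope.

(* The library norm on 'rV[R]_n is the sup norm: it gives the right topology,
   but the truncations |x - y| >= eps call for the Euclidean norm. *)
Definition enorm (R : realType) (n : nat) (x : 'rV[R]_n) : R :=
  Num.sqrt (\sum_(i < n) x 0 i ^+ 2).

(* R^n with its Borel sigma-algebra. *)
Definition borel_space (R : realType) (n : nat) :=
  g_sigma_algebraType (@open 'rV[R]_n).

(* R^n x R^n with the Borel sigma-algebra of its product topology. *)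
Definition borel_space2 (R : realType) (n : nat) :=
  g_sigma_algebraType (@open ('rV[R]_n * 'rV[R]_n)%type).

(* In finite dimension, continuity of all the maps x |-> 'D_v u x is continuity
   of the differential x |-> 'd u x. *)
Definition C1_0 (R : realType) (n : nat) (u : 'rV[R]_n -> R) : Prop :=
  [/\ forall x, differentiable u x,
      forall v : 'rV[R]_n, continuous (fun x => 'D_v u x) &
      compact (closure [set x | u x != 0])].

Section Kernel.
Variables (R : realType) (n : nat).
Variable K : {measure set (borel_space2 R n) -> \bar R}.

Definition locally_finite_off_diagonal : Prop :=
  forall z : 'rV[R]_n * 'rV[R]_n, z.1 <> z.2 ->
    exists U : set ('rV[R]_n * 'rV[R]_n), [/\ open U, U z & (K U < +oo)%E].

Definition symmetric_kernel : Prop :=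
  forall E F : set (borel_space R n), measurable E -> measurable F ->
    K (E `*` F) = K (F `*` E).

Definition square_integrable_near_diagonal : Prop :=
  forall E : set 'rV[R]_n, compact E ->
    (\int[K]_(z in E `*` E) (enorm (z.1 - z.2)%R ^+ 2)%:E < +oo)%E.

Definition finite_tails : Prop :=
  forall r : R, 0 < r ->
    (K [set z : 'rV[R]_n * 'rV[R]_n |
         (enorm z.1 < r)%R /\ (2 * r < enorm (z.2 - z.1))%R] < +oo)%E.

Definition T_trunc (u : 'rV[R]_n -> R) (E : set (borel_space R n)) (eps : R) :
    \bar R :=
  (\int[K]_(z in [set z : 'rV[R]_n * 'rV[R]_n |
                   E z.1 /\ (eps <= enorm (z.1 - z.2))%R]) (u z.1 - u z.2)%:E)%E.

Definition pvT (u : 'rV[R]_n -> R) (E : set (borel_space R n)) : \bar R :=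
  lim (T_trunc u E eps @[eps --> 0^'+]).

(* [lim] and the integral are total. The integral is the difference of those of
   the positive and negative parts, with +oo - +oo = -oo, so a finite limit
   forces absolute convergence of the truncated integrals for small eps. *)
Definition T_exists (u : 'rV[R]_n -> R) : Prop :=
  forall E : set (borel_space R n), measurable E ->
    cvg (T_trunc u E eps @[eps --> 0^'+]) /\ pvT u E \is a fin_num.

Definition pairing_trunc (u v : 'rV[R]_n -> R) (eps : R) : \bar R :=
  (\int[K]_(z in [set z : 'rV[R]_n * 'rV[R]_n | (eps <= enorm (z.1 - z.2))%R])
     ((u z.1 - u z.2) * v z.1)%:E)%E.

(* The integral of v with respect to the set function [pvT u]. *)
Definition pairing (u v : 'rV[R]_n -> R) : \bar R :=
  lim (pairing_trunc u v eps @[eps --> 0^'+]).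

Definition pairing_exists (u v : 'rV[R]_n -> R) : Prop :=
  cvg (pairing_trunc u v eps @[eps --> 0^'+]) /\ pairing u v \is a fin_num.

(* |u|^(q-2) u *)
Definition dual_power (q : R) (u : 'rV[R]_n -> R) : 'rV[R]_n -> R :=
  fun x => `|u x| `^ (q - 2) * u x.

Definition conj_exponent (p : R) : R := p / (p - 1).

Definition Lp_positive (p : R) : Prop :=
  forall u : 'rV[R]_n -> R, C1_0 u ->
    (2 <= p -> (0 <= pairing u (dual_power p u))%E) /\
    (1 < p < 2 -> (0 <= pairing (dual_power (conj_exponent p) u) u)%E).

Definition energy (q : R) (u : 'rV[R]_n -> R) : \bar R :=
  (\int[K]_z ((`|u z.2| `^ (q / 2) - `|u z.1| `^ (q / 2)) ^+ 2)%:E)%E.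

End Kernel.

(* Main.v *)
(* Symmetrizing in (x, y), the truncated pairing of u and v is half the integral
   of (u(x) - u(y))(v(x) - v(y)) over |x - y| >= eps.  For v = |u|^(q-2) u with
   q >= 2 this integrand is nonnegative, and the Stroock-Varopoulos inequality
     (a - b)(|a|^(q-2) a - |b|^(q-2) b)
        >= 4 (q-1)/q^2 (|a|^(q/2) - |b|^(q/2))^2
   bounds it below by a multiple of the energy density, the constant being
   4/(q q') with q' the conjugate exponent.  So the pairing increases as eps
   decreases to 0, and monotone convergence gives the inequality.  The limit is
   finite: u and v are Lipschitz on compact sets, so near the support the
   integrand is O(|x - y|^2), and elsewhere it is bounded and lives on the two
   tails of finite measure.  For p < 2 take q = p' and exchange the roles of u
   and v. *)
Require Import Defs.
From HB Require Import structures.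
From mathcomp Require Import all_boot all_order all_algebra.
From mathcomp Require Import all_classical all_reals all_analysis.
From mathcomp Require Import measurable_realfun ring lra.
Import Order.TTheory GRing.Theory Num.Theory.
Import numFieldTopology.Exports numFieldNormedType.Exports.
Set Implicit Arguments.
Unset Strict Implicit.
Local Open Scope classical_set_scope.
Local Open Scope ring_scope.

(** * The Stroock-Varopoulos inequality *)

Lemma is_derive_powR (R : realType) (a t : R) : 0 < t ->
  is_derive t 1 (@powR R ^~ a) (a * t `^ (a - 1)).
Proof.
move=> t0; have tI : t \in `]0, +oo[ by rewrite in_itv/= t0.
apply: DeriveDef; first exact: derivable_powR.
by have := powR_derive1 a tI; rewrite derive1E.
Qed.

Lemma powR_MVT (R : realType) (a b s : R) : 0 < b -> b <= a ->
  exists2 c, c \in `[b, a]%R & a `^ s - b `^ s = s * c `^ (s - 1) * (a - b).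
Proof.
move=> b0 ba.
apply: (@MVT_segment R (@powR R ^~ s) (fun t => s * t `^ (s - 1))) => // [t|].
  by rewrite in_itv/= => /andP[bt _]; apply: is_derive_powR; exact: lt_trans bt.
apply/derivable_within_continuous => t; rewrite in_itv/= => /andP[bt _].
have t0 : 0 < t by exact: lt_le_trans bt.
by have [] := @is_derive_powR R s t t0.
Qed.

(** [dual_power q u x] is [signed_power q (u x)] by conversion, so the estimates below concern real
    numbers only. *)
Definition signed_power {R : realType} (q t : R) : R := `|t| `^ (q - 2) * t.

Lemma signed_powerN (R : realType) (q t : R) :
  signed_power q (- t) = - signed_power q t.
Proof. by rewrite /signed_power normrN mulrN. Qed.

Lemma signed_power_ge0 (R : realType) (q t : R) : 2 <= q -> 0 <= t ->
  signed_power q t = t `^ (q - 1).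
Proof.
move=> q2 t0; rewrite /signed_power ger0_norm// mulrC.
have -> : q - 2 = q - 1 - 1 by ring.
by rewrite mulr_powRB1//; lra.
Qed.

Lemma norm_signed_power (R : realType) (q t : R) : 2 <= q ->
  `|signed_power q t| = `|t| `^ (q - 1).
Proof.
move=> q2; rewrite /signed_power normrM ger0_norm ?powR_ge0//.
by rewrite -[`|t|]ger0_norm// -signed_power_ge0 /signed_power ?normr_id.
Qed.

(** Both inequalities for signed powers are stable under exchange and under a common sign change,
    which leaves one same-sign case and one opposite-sign case. *)
Lemma signed_pair_ind (R : realType) (P : R -> R -> Prop) :
  (forall a b, P a b -> P b a) -> (forall a b, P a b -> P (- a) (- b)) ->
  (forall a b, 0 <= b -> b <= a -> P a b) ->
  (forall a b, 0 <= b -> b <= a -> P a (- b)) -> forall a b, P a b.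
Proof.
move=> Psym Popp Pge Popos.
have main a b : 0 <= a -> P a b.
  move=> a0; have [b0|/ltW b0] := leP 0 b.
    by have [ba|/ltW ab] := leP b a; [exact: Pge|exact/Psym/Pge].
  have [ba|/ltW ab] := leP (- b) a.
    by rewrite -[b]opprK; apply: Popos => //; rewrite oppr_ge0.
  apply: Psym; rewrite -[a]opprK -[b]opprK; apply/Popp/Popos => //.
move=> a b; have [a0|/ltW a0] := leP 0 a; first exact: main.
by rewrite -[a]opprK -[b]opprK; apply/Popp/main; rewrite oppr_ge0.
Qed.

(** By the mean value theorem, since for [r >= 1] the derivative r c^(r-1) grows with c. The case
    [b = 0] is separate because powers are differentiated only at positive reals. *)
Lemma powR_lipschitz_ge0 (R : realType) (r M a b : R) : 1 <= r ->
  0 <= b -> b <= a -> a <= M ->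
  a `^ r - b `^ r <= r * M `^ (r - 1) * (a - b).
Proof.
move=> r1; rewrite le_eqVlt => /predU1P[<- a0 aM|b0 ba aM].
  have [->|an0] := eqVneq a 0; first by rewrite !subrr mulr0.
  rewrite powR0 ?subr0; last by lra.
  rewrite -mulr_powRB1//; last by lra.
  rewrite mulrC ler_wpM2r// -[leLHS]mul1r ler_pM// ?powR_ge0//.
  by apply: ge0_ler_powR; rewrite ?nnegrE//; lra.
have [c /[!in_itv]/= /andP[bc ca] ->] := powR_MVT r b0 ba.
rewrite ler_wpM2r ?subr_ge0// ler_wpM2l//; first lra.
by apply: ge0_ler_powR; rewrite ?nnegrE//; lra.
Qed.

Lemma signed_power_lipschitz (R : realType) (q M a b : R) : 2 <= q ->
  `|a| <= M -> `|b| <= M ->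
  `|signed_power q a - signed_power q b|
    <= (q - 1) * M `^ (q - 2) * `|a - b|.
Proof.
move=> q2; move: a b; apply: signed_pair_ind => [a b ih bM aM|a b|a b b0 ba|a b b0 ba].
- by rewrite distrC (distrC b); exact: ih.
- rewrite !normrN !signed_powerN => ih aM bM.
  by rewrite -!opprD !normrN; exact: ih.
- have a0 : 0 <= a by lra.
  rewrite (ger0_norm a0) (ger0_norm b0) => aM bM.
  rewrite !signed_power_ge0// !ger0_norm ?subr_ge0//; last first.
    by apply: ge0_ler_powR; rewrite ?nnegrE//; lra.
  have -> : q - 2 = q - 1 - 1 by ring.
  by apply: powR_lipschitz_ge0 => //; lra.
- have a0 : 0 <= a by lra.
  rewrite normrN (ger0_norm a0) (ger0_norm b0) => aM bM.
  rewrite signed_powerN !signed_power_ge0// !opprK !ger0_norm ?addr_ge0 ?powR_ge0//.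
  have e : q - 2 = q - 1 - 1 by ring.
  have q1 : 1 <= q - 1 by lra.
  (* The distance is now [a + b]: each power is compared with its value at 0, and the two bounds are
     added. *)
  have := powR_lipschitz_ge0 q1 (lexx 0) a0 aM.
  have := powR_lipschitz_ge0 q1 (lexx 0) b0 bM.
  rewrite powR0 ?e ?subr0; last by lra.
  by move: (_ `^ _) (_ `^ _) (_ `^ _) => x y z h1 h2; rewrite mulrDr addrC [leRHS]addrC lerD.
Qed.

(* The right-hand side is the integral of (l - t^(q/2-1))^2 over [b, a]; it is
   used at the optimal l, which amounts to the Cauchy-Schwarz inequality. *)
Lemma powR_quadratic_ge0 (R : realType) (q a b l : R) : 2 <= q ->
  0 < b -> b <= a ->
  0 <= l ^+ 2 * (a - b) - 4 / q * l * (a `^ (q / 2) - b `^ (q / 2))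
       + (a `^ (q - 1) - b `^ (q - 1)) / (q - 1).
Proof.
move=> q2 b0 ba.
pose df t := (l - t `^ (q / 2 - 1)) ^+ 2.
pose f : R -> R := (l ^+ 2) \*: (@id R) - (4 / q * l) \*: (@powR R ^~ (q / 2))
          + (q - 1)^-1 \*: (@powR R ^~ (q - 1)).
have fd (t : R) : 0 < t -> is_derive t (1 : R) f (df t).
  move=> t0.
  have h1 := is_derive_powR (q / 2) t0.
  have h2 := is_derive_powR (q - 1) t0.
  apply: is_derive_eq.
  rewrite /df /GRing.scale/=.
  have -> : t `^ (q - 1 - 1) = (t `^ (q / 2 - 1)) ^+ 2.
    by rewrite -powR_mulrn ?powR_ge0// -powRrM; congr (_ `^ _); field.
  by field; lra.
(* No integral is taken: [f a - f b] equals [df c * (a - b)], a product of nonnegative factors. *)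
have [| |c _] := @MVT_segment R f df b a ba.
- by move=> t; rewrite in_itv/= => /andP[bt _]; apply: fd; exact: lt_trans bt.
- apply/derivable_within_continuous => t; rewrite in_itv/= => /andP[bt _].
  by have [] := fd t (lt_le_trans b0 bt).
move=> H; have : 0 <= f a - f b by rewrite H mulr_ge0 ?sqr_ge0// subr_ge0.
rewrite /f /GRing.scale/= !fctE /= /GRing.scale/=.
by congr (_ <= _); field; lra.
Qed.

(** This is Cauchy-Schwarz for t^(q/2-1) on [b, a], whose square has integral (a^(q-1) -
    b^(q-1))/(q-1). *)
Lemma stroock_varopoulos_ge0 (R : realType) (q a b : R) : 2 <= q ->
  0 <= b -> b <= a ->
  4 * (q - 1) / q ^+ 2 * (a `^ (q / 2) - b `^ (q / 2)) ^+ 2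
  <= (a - b) * (a `^ (q - 1) - b `^ (q - 1)).
Proof.
move=> q2; rewrite le_eqVlt => /predU1P[<- a0|b0 ba].
  (* For [b = 0] both sides are multiples of a^q, and the claim becomes 4(q-1) <= q^2, that is
     (q-2)^2 >= 0. *)
  rewrite !powR0 ?subr0; [|lra|lra].
  rewrite -[_ `^ (q / 2) ^+ 2]powR_mulrn ?powR_ge0// -powRrM.
  have -> : q / 2 * 2%:R = q by field.
  rewrite mulr_powRB1//; last lra.
  rewrite -[leRHS]mul1r ler_wpM2r ?powR_ge0//.
  rewrite ler_pdivrMr ?mul1r; last by rewrite exprn_gt0//; lra.
  by have := sqr_ge0 (q - 2); nra.
have [->|ab] := eqVneq a b; first by rewrite !subrr expr0n/= mulr0 mul0r.
have d0 : 0 < a - b by rewrite subr_gt0 lt_neqAle eq_sym ab.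
(* This [l] is the mean of t^(q/2-1) over [b, a], which minimizes the quadratic; multiplying by
   (a-b)(q-1) then gives the claim. *)
have := @powR_quadratic_ge0 R q a b (2 / q * (a `^ (q / 2) - b `^ (q / 2)) / (a - b)) q2 b0 ba.
move: (a `^ (q / 2) - _) (a `^ (q - 1) - _) => X Y.
have qn0 : q != 0 by lra.
have q1n0 : q - 1 != 0 by lra.
have dn0 : a - b != 0 by lra.
move: (a - b) d0 dn0 => d d0 dn0 H.
rewrite -subr_ge0.
suff -> : d * Y - 4 * (q - 1) / q ^+ 2 * X ^+ 2 =
  d * (q - 1) * ((2 / q * X / d) ^+ 2 * d - 4 / q * (2 / q * X / d) * X + Y / (q - 1)).
  by rewrite mulr_ge0// mulr_ge0//; lra.
by field; rewrite qn0 q1n0 dn0.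
Qed.

Lemma stroock_varopoulos (R : realType) (q a b : R) : 2 <= q ->
  4 * (q - 1) / q ^+ 2 * (`|a| `^ (q / 2) - `|b| `^ (q / 2)) ^+ 2
  <= (a - b) * (signed_power q a - signed_power q b).
Proof.
move=> q2; move: a b; apply: signed_pair_ind => [a b|a b|a b b0 ba|a b b0 ba].
- by rewrite -[X in _ * X <= _ -> _]sqrrN -[X in _ <= X -> _]mulrNN !opprB.
- by rewrite !normrN !signed_powerN -!opprD mulrNN.
- have a0 : 0 <= a by lra.
  rewrite !ger0_norm// !signed_power_ge0//; exact: stroock_varopoulos_ge0.
- have a0 : 0 <= a by lra.
  rewrite normrN signed_powerN !opprK !ger0_norm// !signed_power_ge0//.
  (* The left side sees only absolute values, while opposite signs turn both differences on the
     right into sums, which are larger. *)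
  apply: (le_trans (stroock_varopoulos_ge0 q2 b0 ba)).
  by have := powR_ge0 a (q - 1); have := powR_ge0 b (q - 1); nra.
Qed.

(** * Compactly supported C^1 functions *)

Section euclidean_norm.
Variables (R : realType) (n : nat).
Implicit Types x y : 'rV[R]_n.

Lemma coord_le_norm x i : `|x 0 i| <= `|x|.
Proof. by rewrite [leRHS]/Num.norm/= mx_normrE; apply: (le_bigmax _ _ (0, i)). Qed.

Lemma norm_lt_coord x (e : R) : 0 < e -> (forall i, `|x 0 i| < e) -> `|x| < e.
Proof.
move=> e0 xe; rewrite /Num.norm/= mx_normrE; apply: bigmax_lt => //= -[i j] _ /=.
by rewrite ord1.
Qed.

Lemma norm_le_enorm x : `|x| <= enorm x.
Proof.
rewrite /Num.norm/= mx_normrE; apply: bigmax_le => [|[i j] _ /=].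
  exact: sqrtr_ge0.
rewrite ord1 -sqrtr_sqr ler_wsqrtr// (bigD1 j)//= lerDl.
by apply: sumr_ge0 => k _; exact: sqr_ge0.
Qed.

Lemma enorm_le_norm x : enorm x <= n%:R * `|x|.
Proof.
rewrite -[leRHS]ger0_norm ?mulr_ge0//.
rewrite -sqrtr_sqr ler_wsqrtr//.
have : \sum_(i < n) x 0 i ^+ 2 <= \sum_(i < n) `|x| ^+ 2.
  apply: ler_sum => i _; rewrite -[x 0 i ^+ 2]real_normK ?num_real//.
  by rewrite lerXn2r ?nnegrE// coord_le_norm.
move=> /le_trans; apply; rewrite sumr_const card_ord exprMn -[leLHS]mulr_natl.
rewrite ler_wpM2r ?sqr_ge0// -natrX ler_nat.
by case: (n) => // m; rewrite expnS expn1 leq_pmulr.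
Qed.

Lemma enorm_ge0 x : 0 <= enorm x.
Proof. exact: sqrtr_ge0. Qed.

Lemma enormN x : enorm (- x) = enorm x.
Proof.
by rewrite /enorm; congr Num.sqrt; apply: eq_bigr => i _; rewrite mxE sqrrN.
Qed.

Lemma enormB x y : enorm (x - y) = enorm (y - x).
Proof. by rewrite -enormN opprB. Qed.

Lemma enorm0 : enorm (0 : 'rV[R]_n) = 0.
Proof.
by apply/eqP; rewrite eq_le enorm_ge0 andbT (le_trans (enorm_le_norm _))// normr0 mulr0.
Qed.

Lemma enorm_gt0 x : (0 < enorm x) = (x != 0).
Proof.
have [->|x0] := eqVneq x 0; first by rewrite enorm0 ltxx.
by rewrite (lt_le_trans _ (norm_le_enorm x))// normr_gt0.
Qed.

Lemma continuous_enorm : continuous (@enorm R n).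
Proof.
move=> x; apply: (@continuous_comp _ _ _ (fun y => \sum_(i < n) y 0 i ^+ 2) Num.sqrt).
  apply: continuous_big => [|i _ {}x]; first exact: add_continuous.
  apply: (@continuous_comp _ _ _ (fun y : 'rV[R]_n => y 0 i) (fun t => t ^+ 2)).
    exact: coord_continuous.
  exact: exprn_continuous.
exact: sqrt_continuous.
Qed.

Lemma compact_norm_le (r : R) : compact [set x : 'rV[R]_n | `|x| <= r].
Proof.
apply: bounded_closed_compact.
  exists r; split; first exact: num_real.
  by move=> s rs x /= xr; rewrite (le_trans xr)// ltW.
apply: (@closed_comp _ _ (fun x : 'rV[R]_n => `|x|) [set t : R | t <= r]).
  by move=> x _; exact: norm_continuous.
exact: closed_le.
Qed.

(** * Support, bounds and Lipschitz constants *)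

Section C1.
Variable u : 'rV[R]_n -> R.
Hypothesis uC1 : C1_0 u.

Lemma C1_0_continuous : continuous u.
Proof. by case: uC1 => du _ _ x; exact: differentiable_continuous. Qed.

Lemma C1_0_support : exists2 r : R, 0 < r & forall x, u x != 0 -> enorm x < r.
Proof.
case: uC1 => _ _ /compact_bounded[M [_ Mb]].
(* [M] bounds the sup norm; the factor [n] passes to the Euclidean norm, and the last 1 makes the
   radius positive and the bound strict. *)
exists (n%:R * (`|M| + 1) + 1) => [|x ux].
  by rewrite ltr_wpDl// mulr_ge0.
rewrite (le_lt_trans (enorm_le_norm x))// ltr_pwDr// ler_wpM2l//.
apply: Mb; last by apply: subset_closure => /=.
by rewrite (le_lt_trans (ler_norm M))// ltrDl.
Qed.

Lemma C1_0_bounded : exists2 M : R, 0 <= M & forall x, `|u x| <= M.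
Proof.
have [r r0 ur] := C1_0_support.
have cu : {within [set x : 'rV[R]_n | `|x| <= r], continuous u}.
  by apply: continuous_subspaceT; exact: C1_0_continuous.
have /compact_bounded[M [_ Mb]] := continuous_compact cu (@compact_norm_le r).
exists (`|M| + 1) => // x.
have [->|ux] := eqVneq (u x) 0; first by rewrite normr0.
apply: Mb; first by rewrite (le_lt_trans (ler_norm M))// ltrDl.
by exists x => //=; rewrite (le_trans (norm_le_enorm x))// ltW// ur.
Qed.

(** The difference quotients along the line are the directional difference quotients of [u], so no
    chain rule is needed. *)
Lemma is_derive_segment (x v : 'rV[R]_n) (t : R) :
  is_derive t (1 : R) (fun s : R => u (x + s *: v)) ('D_v u (x + t *: v)).
Proof.
have E : (fun h : R => h^-1 *: (((fun s : R => u (x + s *: v)) \o shift t) (h *: (1 : R))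
             - u (x + t *: v))) =
         (fun h : R => h^-1 *: ((u \o shift (x + t *: v)) (h *: v) - u (x + t *: v))).
  apply/funext => h /=; congr (_ *: (u _ - _)).
  by rewrite [h *: 1]mulr1 scalerDl addrCA.
case: uC1 => du _ _.
have dv : derivable u (x + t *: v) v by exact: diff_derivable.
by apply: DeriveDef; rewrite /derivable /derive E.
Qed.

(** The partial derivatives are bounded on the compact sup-norm ball. The ball is convex, so the
    mean value theorem applies along the segment from [y] to [x], and the differential is expanded
    in the canonical basis. *)
Lemma C1_0_lipschitz (r : R) : exists2 L : R, 0 <= L & forall x y,
  `|x| <= r -> `|y| <= r -> `|u x - u y| <= L * enorm (x - y).
Proof.
case: (uC1) => du cu _.
have /choice[M MP] : forall i : 'I_n, exists M : R,
    forall z, `|z| <= r -> `|'D_(delta_mx 0 i) u z| <= M.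
  move=> i.
  have ci : {within [set x : 'rV[R]_n | `|x| <= r], continuous ('D_(delta_mx 0 i) u)}.
    by apply: continuous_subspaceT; exact: cu.
  have /compact_bounded[M [_ Mb]] := continuous_compact ci (@compact_norm_le r).
  exists (`|M| + 1) => z zr; apply: Mb; last by exists z.
  by rewrite (le_lt_trans (ler_norm M))// ltrDl.
exists (\sum_(i < n) `|M i|) => [|x y xr yr]; first exact: sumr_ge0.
pose v := x - y.
have [| |c] := @MVT_segment R (fun s => u (y + s *: v))
  (fun s => 'D_v u (y + s *: v)) 0 1 ler01.
- by move=> t _; exact: is_derive_segment.
- apply/derivable_within_continuous => t _.
  by have [] := is_derive_segment y v t.
rewrite in_itv/= => /andP[c0 c1].
rewrite scale1r scale0r addr0 [in u (y + v)]addrC [in u (v + y)]subrK subr0 mulr1 => ->.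
rewrite -/v; set z := y + c *: v.
have zr : `|z| <= r.
  have -> : z = c *: x + (1 - c) *: y.
    by rewrite /z /v scalerBr scalerBl scale1r addrCA addrC -addrA.
  rewrite (le_trans (ler_normD _ _))// !normrZ !ger0_norm ?subr_ge0//.
  have -> : r = c * r + (1 - c) * r by ring.
  by rewrite lerD// ler_wpM2l// subr_ge0.
rewrite deriveE// [X in 'd _ _ X]row_sum_delta linear_sum.
rewrite (le_trans (ler_norm_sum _ _ _))// mulr_suml; apply: ler_sum => i _.
rewrite linearZ/= -deriveE// normrM mulrC ler_pM//.
  by rewrite (le_trans (MP i z zr))// ler_norm.
by rewrite (le_trans (coord_le_norm v i))// norm_le_enorm.
Qed.

End C1.
End euclidean_norm.

(** * Invariance of the kernel under exchange of variables *)

Section borel.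
Variables (R : realType) (n : nat).
Local Notation V := 'rV[R]_n.
Local Notation V2 := ('rV[R]_n * 'rV[R]_n)%type.

Lemma continuous_measurable_borel (f : V -> R) :
  continuous f -> measurable_fun [set: borel_space R n] (f : borel_space R n -> R).
Proof.
move=> /continuousP cf; apply: (measurability _ (RGenOpens.measurableE R)).
move=> _ [_ [a [b ->] <-]]; rewrite setTI; apply: sub_sigma_algebra.
exact/cf/interval_open.
Qed.

Lemma continuous_measurable_borel2 (f : V2 -> R) :
  continuous f -> measurable_fun [set: borel_space2 R n] (f : borel_space2 R n -> R).
Proof.
move=> /continuousP cf; apply: (measurability _ (RGenOpens.measurableE R)).
move=> _ [_ [a [b ->] <-]]; rewrite setTI; apply: sub_sigma_algebra.
exact/cf/interval_open.
Qed.

Lemma measurable_borel_swap :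
  measurable_fun [set: borel_space2 R n] (@swap_pair V V : borel_space2 R n -> borel_space2 R n).
Proof.
apply: (@measurability _ _ _ (borel_space2 R n) _ _ (@open V2)) => //.
move=> _ [A oA <-]; rewrite setTI; apply: sub_sigma_algebra.
by have /continuousP := @swap_continuous V V; exact.
Qed.

Lemma measurable_borel_fst :
  measurable_fun [set: borel_space2 R n] (fst : borel_space2 R n -> borel_space R n).
Proof.
apply: (@measurability _ _ _ (borel_space R n) _ _ (@open V)) => //.
move=> _ [A oA <-]; rewrite setTI; apply: sub_sigma_algebra.
by apply: open_comp oA => z _; exact: cvg_fst.
Qed.

Lemma measurable_borel_snd :
  measurable_fun [set: borel_space2 R n] (snd : borel_space2 R n -> borel_space R n).
Proof.
apply: (@measurability _ _ _ (borel_space R n) _ _ (@open V)) => //.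
move=> _ [A oA <-]; rewrite setTI; apply: sub_sigma_algebra.
by apply: open_comp oA => z _; exact: cvg_snd.
Qed.

Lemma measurable_borel_setX (E F : set (borel_space R n)) :
  measurable E -> measurable F -> measurable (E `*` F : set (borel_space2 R n)).
Proof.
move=> mE mF.
have -> : E `*` F = (fst @^-1` E) `&` (snd @^-1` F) by [].
apply: (@measurableI _ (borel_space2 R n)); rewrite -[X in measurable X]setTI.
  exact: measurable_borel_fst.
exact: measurable_borel_snd.
Qed.

Definition offdiag : set (borel_space2 R n) := [set z | z.1 != z.2].

Lemma open_offdiag : open (offdiag : set V2).
Proof.
have -> : offdiag = (fun z : V2 => z.1 - z.2) @^-1` (~` [set 0]).
  by apply/seteqP; split => z; rewrite /offdiag/= -subr_eq0 => /eqP.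
apply: open_comp => [z _|]; first by apply: cvgB; [exact: cvg_fst|exact: cvg_snd].
by apply: closed_openC; apply: accessible_closed_set1; apply: hausdorff_accessible; exact: norm_hausdorff.
Qed.

Lemma measurable_offdiag : measurable offdiag.
Proof. by apply: sub_sigma_algebra; exact: open_offdiag. Qed.

(** * A countable basis of rational boxes *)

Definition rat_cube (c : 'rV[rat]_n) (k : nat) : set V :=
  @ball R V (map_mx ratr c) k.+1%:R^-1.

Definition rat_box (i : 'rV[rat]_n * 'rV[rat]_n * nat) : set V2 :=
  rat_cube i.1.1 i.2 `*` rat_cube i.1.2 i.2.

Lemma open_rat_cube c k : open (rat_cube c k).
Proof.
by apply: ball_open; rewrite invr_gt0.
Qed.

Lemma rat_cube_exists (x : V) (k : nat) : exists c, rat_cube c k x.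
Proof.
have k0 : (0 : R) < k.+1%:R^-1 by rewrite invr_gt0.
have /choice[c cP] : forall j : 'I_n, exists q : rat,
    `|x 0 j - ratr q| < k.+1%:R^-1.
  move=> j; have [|q] := @rat_in_itvoo R (x 0 j - k.+1%:R^-1) (x 0 j + k.+1%:R^-1).
    by rewrite ltrD2l gtrN.
  by rewrite in_itv/= => qx; exists q; rewrite distrC ltr_distl.
by exists (\row_j c j); rewrite /rat_cube -ball_normE/= distrC; apply: norm_lt_coord => // j; rewrite !mxE.
Qed.

(** Two points of a cube of radius at most e/2 are within e of each other, so any small enough box
    containing [z] stays in [U]. *)
Lemma rat_box_basis (U : set V2) (z : V2) : open U -> U z ->
  exists i, rat_box i z /\ rat_box i `<=` U.
Proof.
rewrite openE => /(_ z)/[apply]/nbhs_ballP[e/= e0 zU].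
have [k] : exists k : nat, 0 + k.+1%:R^-1 < e / 2 by apply: ltr_add_invr; rewrite divr_gt0.
rewrite add0r => ke.
have [c1 zc1] := rat_cube_exists z.1 k; have [c2 zc2] := rat_cube_exists z.2 k.
have near (x y : V) c : rat_cube c k x -> rat_cube c k y -> ball x e y.
  move=> /(le_ball (ltW ke)) xc /(le_ball (ltW ke)) yc.
  exact: ball_splitr xc yc.
exists (c1, c2, k); split=> // y [y1 y2]; apply: zU.
by split; [exact: near zc1 y1|exact: near zc2 y2].
Qed.

(** * Uniqueness of measures applied to the exchanged kernel *)

Section swap_invariance.
Variable K : {measure set (borel_space2 R n) -> \bar R}.
Hypothesis Kloc : locally_finite_off_diagonal K.
Hypothesis Ksym : symmetric_kernel K.

(** A class stable under intersection: on its rectangles the two measures agree by symmetry of [K],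
    and on its subsets of the diagonal both vanish. *)
Let rects : set (set (borel_space2 R n)) := [set A : set (borel_space2 R n) |
  (exists E F : set (borel_space R n),
     [/\ measurable E, measurable F, A = E `*` F & A `<=` offdiag]) \/
  (@measurable _ (borel_space2 R n) A /\ A `<=` ~` offdiag)].

Let mrects : rects `<=` measurable.
Proof.
move=> A [[E [F [mE mF -> _]]]|[mA _]//].
exact: measurable_borel_setX.
Qed.

Let rectsI : setI_closed rects.
Proof.
move=> A B rA rB.
case: (rA) => [[E [F [mE mF AEF Ao]]]|[mA Ad]]; last first.
  right; split; last by move=> z [/Ad].
  by apply: measurableI => //; exact: mrects.
case: (rB) => [[E' [F' [mE' mF' BEF Bo]]]|[mB Bd]]; last first.
  right; split; last by move=> z [_ /Bd].
  by apply: measurableI => //; exact: mrects.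
left; exists (E `&` E'), (F `&` F'); split; [exact: measurableI|exact: measurableI| |].
  by rewrite AEF BEF setXI.
by move=> z [/Ao].
Qed.

(** An enumeration of the rational boxes off the diagonal that satisfy [P], padded with empty sets.
    [P] is finite measure for the cover [g], and inclusion in an open set for generation. *)
Let cell (P : set (borel_space2 R n) -> Prop) (k : nat) : set (borel_space2 R n) :=
  if unpickle k is Some i then
    if `[< P (rat_box i) /\ rat_box i `<=` offdiag >] then rat_box i else set0
  else set0.

Let rects0 : rects set0.
Proof. by right; split => //; exact: measurable0. Qed.

Let rects_cell P k : rects (cell P k).
Proof.
rewrite /cell; case: unpickle => [i|]; last exact: rects0.
case: asboolP => [[_ io]|_]; last exact: rects0.
left; exists (rat_cube i.1.1 i.2), (rat_cube i.1.2 i.2); split => //.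
- by apply: sub_sigma_algebra; exact: open_rat_cube.
- by apply: sub_sigma_algebra; exact: open_rat_cube.
Qed.

(** The sigma-finite cover required for uniqueness: first the diagonal, null for the restricted
    measure, then boxes of finite measure. *)
Let g k := if k is k'.+1 then cell (fun A => (K A < +oo)%E) k' else ~` offdiag.

Let rects_g k : rects (g k).
Proof.
case: k => [|k] /=; last exact: rects_cell.
by right; split => //; apply: measurableC; exact: measurable_offdiag.
Qed.

Let g_cover : \bigcup_k g k = setT.
Proof.
rewrite -subTset => z _; have [zd|/eqP zo] := eqVneq z.1 z.2.
  by exists 0%N => //=; rewrite /offdiag/= zd eqxx.
have [U [oU Uz KU]] := Kloc zo.
have [|i [iz iU]] := @rat_box_basis (U `&` offdiag) z (openI oU open_offdiag).
  by split => //; exact/eqP.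
exists (pickle i).+1 => //=; rewrite /cell pickleK; case: asboolP => // -[]; split.
  rewrite (le_lt_trans _ KU)// le_measure// ?inE.
  - by apply: measurable_borel_setX; apply: sub_sigma_algebra; exact: open_rat_cube.
  - exact: sub_sigma_algebra.
  - by move=> y /iU[].
by move=> y /iU[].
Qed.

(** An open set is its trace on the diagonal together with the countably many rational boxes off the
    diagonal that it contains. *)
Let rects_gen : @measurable _ (borel_space2 R n) `<=` <<s rects >>.
Proof.
apply: smallest_sub; first exact: smallest_sigma_algebra.
move=> U oU.
have -> : U = (U `&` ~` offdiag) `|` \bigcup_k cell (fun A => A `<=` U) k.
  apply/seteqP; split=> z.
    move=> Uz; have [zo|zo] := pselect (offdiag z); last by left.
    have [//|i [iz iU]] := @rat_box_basis (U `&` offdiag) z (openI oU open_offdiag).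
    right; exists (pickle i) => //; rewrite /cell pickleK; case: asboolP => // -[].
    by split => y /iU[].
  move=> [[]//|[k _]]; rewrite /cell; case: unpickle => // i.
  by case: asboolP => // -[iU _] /iU.
apply: (@measurableU _ (g_sigma_algebraType rects)).
  apply: sub_sigma_algebra; right; split=> [|z []//].
  apply: measurableI; first exact: sub_sigma_algebra.
  by apply: measurableC; exact: measurable_offdiag.
apply: (@bigcupT_measurable _ (g_sigma_algebraType rects)) => k.
by apply: sub_sigma_algebra; exact: rects_cell.
Qed.

(* [K] need not be sigma-finite on the diagonal, so rectangles alone do not
   determine it: its restriction off the diagonal is compared with the image of
   that restriction under [swap_pair], on rectangles avoiding the diagonal and on
   arbitrary Borel subsets of the diagonal. *)
Lemma kernel_swap (A : set (borel_space2 R n)) : measurable A -> A `<=` offdiag ->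
  K (@swap_pair V V @^-1` A) = K A.
Proof.
move=> mA Ao.
pose m1 : {measure set (borel_space2 R n) -> \bar R} := mrestr K measurable_offdiag.
have [m2 m2K] : exists m2 : {measure set (borel_space2 R n) -> \bar R},
    forall B, m2 B = m1 (@swap_pair V V @^-1` B).
  pose sw : borel_space2 R n -> borel_space2 R n := @swap_pair V V.
  by unshelve eexists; [apply: (pushforward m1 sw); exact: measurable_borel_swap|].
have m1E B : B `<=` offdiag -> m1 B = K B.
  by move=> Bo; rewrite /m1/= /mrestr setIidl.
have swo B : B `<=` offdiag -> @swap_pair V V @^-1` B `<=` offdiag.
  by move=> Bo z /Bo; rewrite /offdiag/= eq_sym.
have m2E B : B `<=` offdiag -> m2 B = K (@swap_pair V V @^-1` B).
  by move=> Bo; rewrite m2K m1E//; exact: swo.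
rewrite -(m1E _ Ao) -(m2E _ Ao); apply/esym.
apply: (@g_sigma_algebra_measure_unique _ _ _ rects mrects g rects_g g_cover m1 m2 rectsI) => //.
- move=> B [[E [F [mE mF BEF Bo]]]|[mB Bd]].
    rewrite m1E// m2E// BEF Ksym//; congr (K _).
    by apply/seteqP; split => z [].
  rewrite m2K /m1/= /mrestr.
  have -> : B `&` offdiag = set0 by apply/seteqP; split => z // [/Bd].
  suff -> : (@swap_pair V V @^-1` B) `&` offdiag = set0 by [].
  by apply/seteqP; split => z // [/Bd]; rewrite /offdiag/= eq_sym.
- case=> [|k] /=.
    rewrite /m1/= /mrestr setICl measure0//.
  rewrite /cell; case: unpickle => [i|]; last by rewrite measure0.
  case: asboolP => [[Ki io]|_]; last by rewrite measure0.
  by rewrite m1E.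
exact: rects_gen.
Qed.

(** Change of variables: on subsets of [A] the image of [K] is [K] by [kernel_swap], and [A] is its
    own preimage. *)
Lemma integral_swap (A : set (borel_space2 R n)) (f : borel_space2 R n -> R) :
  measurable A -> A `<=` offdiag -> @swap_pair V V @^-1` A = A ->
  measurable_fun setT f ->
  K.-integrable A (EFin \o (f \o @swap_pair V V)) ->
  (\int[K]_(z in A) (f z)%:E = \int[K]_(z in A) (f (swap_pair z))%:E)%E.
Proof.
move=> mA Ao swA mf intf.
have msw := measurable_borel_swap.
transitivity (\int[pushforward K (@swap_pair V V : borel_space2 R n -> borel_space2 R n)]_(z in A)
   (f z)%:E)%E.
  apply: eq_measure_integral => B mB BA.
  apply/esym/kernel_swap => //; exact: subset_trans Ao.
rewrite integral_pushforward//= ?swA//.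
exact/measurable_EFinP.
Qed.

End swap_invariance.
End borel.

(** * Symmetrized pairings *)

Section pairing.
Variables (R : realType) (n : nat).
Local Notation V := 'rV[R]_n.
Local Notation V2 := ('rV[R]_n * 'rV[R]_n)%type.

Lemma continuous_enormB : continuous (fun z : V2 => enorm (z.1 - z.2)).
Proof.
move=> z; apply: (@continuous_comp _ _ _ (fun z : V2 => z.1 - z.2) (@enorm R n)).
  by apply: cvgB; [exact: cvg_fst|exact: cvg_snd].
exact: continuous_enorm.
Qed.

Lemma enormB_eq0 (z : V2) : z.1 = z.2 -> enorm (z.1 - z.2) = 0.
Proof. by move=> ->; rewrite subrr enorm0. Qed.

Definition off_band (eps : R) : set (borel_space2 R n) :=
  [set z | eps <= enorm (z.1 - z.2)].

Lemma measurable_off_band eps : measurable (off_band eps).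
Proof.
have -> : off_band eps = [set: borel_space2 R n] `&`
    (fun z : borel_space2 R n => enorm (z.1 - z.2)) @^-1` `[eps, +oo[%classic.
  by apply/seteqP; split => z; rewrite /off_band/= in_itv/= andbT// => -[].
apply: (continuous_measurable_borel2 continuous_enormB) => //.
Qed.

Lemma off_band_offdiag eps : 0 < eps -> off_band eps `<=` @offdiag R n.
Proof.
move=> e0 z ez; rewrite /offdiag/=; apply/eqP => /enormB_eq0 zz.
by move: ez; rewrite /off_band/= zz leNgt e0.
Qed.

Lemma off_band_swap eps : @swap_pair V V @^-1` off_band eps = off_band eps.
Proof. by apply/seteqP; split=> z; rewrite /off_band/= enormB. Qed.

(** The shift to [k.+2] keeps the radii strictly below 1, as [le_S] will require. *)
Lemma bigcup_off_band : \bigcup_k off_band k.+2%:R^-1 = @offdiag R n.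
Proof.
apply/seteqP; split=> [z [k _]|z].
  by apply: off_band_offdiag; rewrite invr_gt0.
rewrite /offdiag/= -subr_eq0 -enorm_gt0 => /ltr_add_invr[k]; rewrite add0r => kz.
exists k => //=; apply/ltW/(le_lt_trans _ kz).
by rewrite lef_pV2 ?posrE// ler_nat.
Qed.

(** * An integrable dominating function *)

Definition tail (r : R) : set (borel_space2 R n) :=
  [set z | enorm z.1 < r /\ 2 * r < enorm (z.2 - z.1)].

Definition cube2 (r : R) : set (borel_space2 R n) :=
  [set x : V | `|x| <= r] `*` [set x : V | `|x| <= r].

Lemma measurable_tail r : measurable (tail r).
Proof.
have -> : tail r = (fst @^-1` ((@enorm R n) @^-1` `]-oo, r[%classic)) `&`
    (fun z : borel_space2 R n => enorm (z.1 - z.2)) @^-1` `]2 * r, +oo[%classic.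
  by apply/seteqP; split => z; rewrite /tail/= !in_itv/= andbT enormB.
apply: measurableI; last first.
  rewrite -[X in measurable X]setTI.
  exact: (continuous_measurable_borel2 continuous_enormB).
rewrite -[X in measurable X]setTI; apply: measurable_borel_fst => //.
rewrite -[X in measurable X]setTI.
exact: (continuous_measurable_borel (@continuous_enorm R n)).
Qed.

Lemma tail_offdiag r : 0 < r -> tail r `<=` @offdiag R n.
Proof.
move=> r0 z [_ rz]; rewrite /offdiag/=; apply/eqP => zz.
by move: rz; rewrite zz subrr enorm0 ltNge mulr_ge0// ltW.
Qed.

Lemma measurable_cube2 r : measurable (cube2 r).
Proof.
have mc : measurable ([set x : V | `|x| <= r] : set (borel_space R n)).
  have -> : [set x : V | `|x| <= r] = ~` [set x : V | r < `|x|].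
    by apply/seteqP; split => x /=; rewrite leNgt => /negP.
  apply: measurableC; apply: sub_sigma_algebra.
  apply: (@open_comp _ _ (fun x : V => `|x|) [set t : R | r < t]).
    by move=> x _; exact: norm_continuous.
  exact: open_gt.
exact: measurable_borel_setX.
Qed.

(** Square integrability near the diagonal controls the first term, the finite tails the second, and
    symmetry carries this over to the third. *)
Definition dominating (r : R) (z : borel_space2 R n) : R :=
  enorm (z.1 - z.2) ^+ 2 * \1_(cube2 (3 * r)) z
  + (\1_(tail r) z + \1_(@swap_pair V V @^-1` tail r) z).

Lemma dominating_ge0 r z : 0 <= dominating r z.
Proof. by rewrite /dominating !addr_ge0// mulr_ge0// sqr_ge0. Qed.

(* When one point lies in the ball of radius [r], the pair lies in the compact
   square [cube2 (3 * r)] or in one of the two tails. *)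
Lemma le_dominating (r B C t : R) (z : V2) : 0 <= B -> 0 <= C ->
  (t != 0 -> enorm z.1 < r \/ enorm z.2 < r) -> `|t| <= B ->
  (cube2 (3 * r) z -> `|t| <= C * enorm (z.1 - z.2) ^+ 2) ->
  `|t| <= (B + C) * dominating r z.
Proof.
move=> B0 C0 tz tB tC.
have [->|/tz zr] := eqVneq t 0.
  by rewrite normr0 mulr_ge0 ?dominating_ge0// addr_ge0.
have e0 : 0 <= enorm (z.1 - z.2) ^+ 2 by exact: sqr_ge0.
have i0 A : (0 : R) <= \1_A z by [].
have [zc|zc] := pselect (cube2 (3 * r) z).
  rewrite (le_trans (tC zc))// /dominating indicE mem_set// mulr1.
  rewrite ler_pM ?lerDr ?lerDl ?addr_ge0//.
suff d1 : 1 <= dominating r z.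
  rewrite (le_trans tB)// -[leLHS]mulr1 ler_pM// lerDl//.
rewrite /dominating (_ : \1_(cube2 _) z = 0) ?mulr0 ?add0r; last first.
  by rewrite indicE memNset.
(* This is the origin of 3r: a partner at distance at most 2r from a point of the r-ball has norm at
   most 3r. *)
have cz (x y : V) : enorm x < r -> enorm (x - y) <= 2 * r ->
    `|x| <= 3 * r /\ `|y| <= 3 * r.
  move=> /ltW/(le_trans (norm_le_enorm x)) xr /(le_trans (norm_le_enorm _)) xyr.
  have r0 : 0 <= r by exact: le_trans xr.
  split; first by lra.
  have : `|y| <= `|x| + `|x - y| by rewrite -{1}[y](subKr x) ler_normB.
  by lra.
case: zr => zr.
  have [/(cz _ _ zr)[z1 z2]|zt] := leP (enorm (z.1 - z.2)) (2 * r).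
    by case: zc.
  by rewrite [\1_(tail r) z]indicE mem_set ?lerDl// /tail/= enormB.
have [|zt] := leP (enorm (z.2 - z.1)) (2 * r).
  by move=> /(cz _ _ zr)[z1 z2]; case: zc.
by rewrite [\1_(_ @^-1` _) z]indicE mem_set ?lerDr// /tail/= enormB.
Qed.

Section kernel.
Variable K : {measure set (borel_space2 R n) -> \bar R}.
Hypothesis Kloc : locally_finite_off_diagonal K.
Hypothesis Ksym : symmetric_kernel K.
Hypothesis Kdiag : square_integrable_near_diagonal K.
Hypothesis Ktails : finite_tails K.

Lemma integrable_kernel_indic (A : set (borel_space2 R n)) : measurable A ->
  (K A < +oo)%E -> K.-integrable setT (EFin \o \1_A).
Proof.
move=> mA KA; apply/integrableP; split; first exact/measurable_EFinP.
under eq_integral do rewrite /= ger0_norm//.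
by rewrite integral_indic// setIT.
Qed.

Lemma integrable_dominating r : 0 < r -> K.-integrable setT (EFin \o dominating r).
Proof.
move=> r0.
have Ktail := Ktails r0.
have mt := measurable_tail r.
have mst : measurable (@swap_pair V V @^-1` tail r : set (borel_space2 R n)).
  by rewrite -[X in measurable X]setTI; exact: measurable_borel_swap.
have e2 : measurable_fun [set: borel_space2 R n]
    (fun z : borel_space2 R n => enorm (z.1 - z.2) ^+ 2).
  by apply: measurable_funX; exact: (continuous_measurable_borel2 continuous_enormB).
have i1 : K.-integrable setT (fun z : borel_space2 R n =>
    (enorm (z.1 - z.2) ^+ 2 * \1_(cube2 (3 * r)) z)%:E).
  have -> : (fun z : borel_space2 R n => (enorm (z.1 - z.2) ^+ 2 * \1_(cube2 (3 * r)) z)%:E)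
    = (fun z : borel_space2 R n => (enorm (z.1 - z.2) ^+ 2)%:E) \_ (cube2 (3 * r)).
    apply/funext => z; rewrite patchE indicE.
    by case: (z \in cube2 (3 * r)); rewrite ?mulr1 ?mulr0.
  apply/(integrable_mkcond _ (measurable_cube2 (3 * r))).
  apply/integrableP; split.
    by apply/measurable_EFinP; exact: measurable_funTS.
  under eq_integral do rewrite /= ger0_norm ?sqr_ge0//.
  exact: Kdiag (@compact_norm_le R n (3 * r)).
have i2 := integrable_kernel_indic mt Ktail.
have Kst : (K (@swap_pair V V @^-1` tail r) < +oo)%E.
  by rewrite kernel_swap//; exact: tail_offdiag.
have i3 := integrable_kernel_indic mst Kst.
have := integrableD measurableT i1 (integrableD measurableT i2 i3).
by apply: eq_integrable => // z _; rewrite /= /dominating !EFinD.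
Qed.

(** * Monotone limits of symmetrized truncations *)

Section pair.
Variables (a b : V -> R) (r M C : R).
Hypothesis r0 : 0 < r.
Hypothesis ma : measurable_fun [set: borel_space R n] (a : borel_space R n -> R).
Hypothesis mb : measurable_fun [set: borel_space R n] (b : borel_space R n -> R).
Hypothesis ra : forall x, a x != 0 -> enorm x < r.
Hypothesis rb : forall x, b x != 0 -> enorm x < r.
Hypothesis M0 : 0 <= M.
Hypothesis Ma : forall x, `|a x| <= M.
Hypothesis Mb : forall x, `|b x| <= M.
Hypothesis C0 : 0 <= C.
Hypothesis lip : forall x y, `|x| <= 3 * r -> `|y| <= 3 * r ->
  `|(a x - a y) * (b x - b y)| <= C * enorm (x - y) ^+ 2.
Hypothesis mono : forall x y, 0 <= (a x - a y) * (b x - b y).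

Let phi (z : borel_space2 R n) : R := (a z.1 - a z.2) * b z.1.
(** The symmetrization [phi z + phi (swap_pair z)] of the pairing integrand. *)
Let h (z : borel_space2 R n) : R := (a z.1 - a z.2) * (b z.1 - b z.2).

Let mcomp (f : V -> R) : measurable_fun [set: borel_space R n] (f : borel_space R n -> R) ->
  measurable_fun [set: borel_space2 R n] (fun z : borel_space2 R n => f z.1) /\
  measurable_fun [set: borel_space2 R n] (fun z : borel_space2 R n => f z.2).
Proof.
move=> mf; split.
  exact: (measurableT_comp mf (@measurable_borel_fst R n)).
exact: (measurableT_comp mf (@measurable_borel_snd R n)).
Qed.

Let mphi : measurable_fun setT phi.
Proof.
have [ma1 ma2] := mcomp ma; have [mb1 mb2] := mcomp mb.
by apply: measurable_funM => //; exact: measurable_funB.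
Qed.

Let mh : measurable_fun setT h.
Proof.
have [ma1 ma2] := mcomp ma; have [mb1 mb2] := mcomp mb.
by apply: measurable_funM; exact: measurable_funB.
Qed.

Let normB_le (f : V -> R) x y : (forall x, `|f x| <= M) -> `|f x - f y| <= M + M.
Proof. by move=> fM; rewrite (le_trans (ler_normB _ _))// lerD. Qed.

Let h_dom z : h z <= ((M + M) * (M + M) + C) * dominating r z.
Proof.
rewrite (le_trans (ler_norm _))//; apply: le_dominating => //.
- by rewrite mulr_ge0// addr_ge0.
- move=> hz; have [a1|/ra] := eqVneq (a z.1) 0; last by left.
  have [a2|/ra] := eqVneq (a z.2) 0; last by right.
  by move: hz; rewrite /h a1 a2 subrr mul0r eqxx.
- by rewrite normrM ler_pM// normB_le.
- by move=> [z1 z2]; exact: lip.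
Qed.

Let integrable_h : K.-integrable setT (EFin \o h).
Proof.
apply: (@le_integrable _ _ _ _ _ _ _
  (fun z => (((M + M) * (M + M) + C)%:E * (dominating r z)%:E)%E)) => //.
- exact/measurable_EFinP.
- move=> z _; rewrite -EFinM !abse_EFin lee_fin.
  by rewrite ger0_norm ?mono// (le_trans (h_dom z))// ler_norm.
- by apply: integrableZl => //; exact: integrable_dominating.
Qed.

Let phi_bound (x y : V) : `|(a x - a y) * b x| <= (M + M) * M.
Proof. by rewrite normrM ler_pM// normB_le. Qed.

Let integrable_off_band (f : borel_space2 R n -> R) (eps : R) : 0 < eps ->
  measurable_fun setT f ->
  (forall z, f z != 0 -> enorm z.1 < r \/ enorm z.2 < r) ->
  (forall z, `|f z| <= (M + M) * M) ->
  K.-integrable (off_band eps) (EFin \o f).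
Proof.
move=> e0 mf fr fM; pose B := (M + M) * M.
have B0 : 0 <= B by rewrite mulr_ge0// addr_ge0.
apply: (@le_integrable _ _ _ _ _ _ _
  (fun z => ((B + B / eps ^+ 2)%:E * (dominating r z)%:E)%E)).
- exact: measurable_off_band.
- by apply/measurable_EFinP; exact: measurable_funTS.
- move=> z ez; rewrite -EFinM !abse_EFin lee_fin.
  rewrite [leRHS]ger0_norm; last first.
    by rewrite mulr_ge0 ?dominating_ge0// addr_ge0// divr_ge0// sqr_ge0.
  apply: le_dominating => //; [by rewrite divr_ge0// sqr_ge0|exact: fr|].
  move=> _; rewrite (le_trans (fM z))// -/B -mulrA -[leLHS]mulr1 ler_wpM2l//.
  rewrite ler_pdivlMl ?exprn_gt0// mulr1 lerXn2r ?nnegrE ?enorm_ge0//.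
  exact: ltW.
- apply: integrableZl; first exact: measurable_off_band.
  apply: (integrableS measurableT (measurable_off_band eps)) => //.
  exact: integrable_dominating.
Qed.

Let phi_swap z : phi (swap_pair z) = (a z.2 - a z.1) * b z.2.
Proof. by []. Qed.

(** [phi] and its exchange are separately integrable on the symmetric set [off_band eps] and have
    equal integrals there; their sum is [h]. *)
Let pairing_truncE eps : 0 < eps ->
  pairing_trunc K a b eps = (2^-1%:E * \int[K]_(z in off_band eps) (h z)%:E)%E.
Proof.
move=> e0.
have iphi : K.-integrable (off_band eps) (EFin \o phi).
  apply: integrable_off_band => // z; last exact: phi_bound.
  by rewrite /phi mulf_eq0 negb_or => /andP[_ /rb]; left.
have iphis : K.-integrable (off_band eps) (EFin \o (phi \o @swap_pair V V)).
  apply: integrable_off_band => //; last by move=> z; exact: phi_bound.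
    exact: (measurableT_comp mphi (@measurable_borel_swap R n)).
  by move=> z; rewrite /= phi_swap mulf_eq0 negb_or => /andP[_ /rb]; right.
have mA := measurable_off_band eps.
have E : (\int[K]_(z in off_band eps) (h z)%:E =
    \int[K]_(z in off_band eps) (phi z)%:E + \int[K]_(z in off_band eps) (phi z)%:E)%E.
  rewrite [X in (_ = _ + X)%E](@integral_swap _ _ _ Kloc Ksym)//; last 2 first.
  - exact: off_band_offdiag.
  - exact: off_band_swap.
  rewrite -(integralD mA iphi iphis); apply: eq_integral => z _.
  by rewrite /= -EFinD; congr EFin; rewrite phi_swap /h /phi; ring.
rewrite E [LHS](_ : _ = \int[K]_(z in off_band eps) (phi z)%:E)%E//.
(* Finiteness of the integral moves the identity I = (I + I)/2 to the reals. *)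
have /fineK <- := integrable_fin_num mA iphi.
by rewrite -EFinD -EFinM; congr EFin; field.
Qed.

Let S := ereal_sup (pairing_trunc K a b @` `]0, 1[%classic).

(** As eps decreases the domain grows, and [h] is nonnegative, so the limit is a supremum; the
    endpoint 1 is an arbitrary choice. *)
Let pairing_cvg : pairing_trunc K a b eps @[eps --> 0^'+] --> S.
Proof.
apply: (@nonincreasing_at_right_cvge _ _ _ (BLeft 1)); first by rewrite bnd_simp.
move=> s t /[!in_itv]/= /andP[s0 _] /andP[t0 _] st.
rewrite !pairing_truncE// lee_wpmul2l ?lee_fin//.
apply: (ge0_subset_integral K (measurable_off_band t) (measurable_off_band s)).
- by apply/measurable_EFinP; exact: measurable_funTS.
- by move=> z _; rewrite lee_fin mono.
- by move=> z; rewrite /off_band/=; exact: le_trans.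
Qed.

Let pairingE : pairing K a b = S.
Proof. by apply/cvg_lim => //; exact: pairing_cvg. Qed.

Let le_S eps : 0 < eps -> eps < 1 ->
  (2^-1%:E * \int[K]_(z in off_band eps) (h z)%:E <= S)%E.
Proof.
move=> e0 e1; rewrite -pairing_truncE//; apply: ereal_sup_ubound.
by exists eps => //=; rewrite in_itv/= e0.
Qed.

(** Every truncation is at most half the integral of [h] over the whole space, which is finite by
    domination. *)
Lemma pairing_exists_of_monotone : pairing_exists K a b.
Proof.
split; first by apply/cvg_ex; exists S; exact: pairing_cvg.
rewrite pairingE ge0_fin_numE; last first.
  apply: le_trans (le_S (_ : 0 < 2^-1) _); [|by []|by rewrite invf_lt1// ltr1n].
  by rewrite mule_ge0 ?lee_fin//; apply: integral_ge0 => z _; rewrite lee_fin mono.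
apply: (@le_lt_trans _ _ (2^-1%:E * \int[K]_z (h z)%:E)%E).
  apply: ge_ereal_sup => _ [eps /= + <-]; rewrite in_itv/= => /andP[e0 _].
  rewrite pairing_truncE// lee_wpmul2l ?lee_fin//.
  apply: (ge0_subset_integral K (measurable_off_band eps) measurableT) => //.
    exact/measurable_EFinP.
  by move=> z _; rewrite lee_fin mono.
have /fineK <- := integrable_fin_num measurableT integrable_h.
by rewrite -EFinM ltry.
Qed.

(** The pointwise bound is integrated over [off_band k.+2%:R^-1], and monotone convergence exhausts
    the complement of the diagonal. *)
Lemma pairing_ge_energy (e : borel_space2 R n -> R) (c : R) : 0 < c ->
  measurable_fun setT e -> (forall z, 0 <= e z) ->
  (forall z, c * e z <= (a z.1 - a z.2) * (b z.1 - b z.2)) ->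
  ((c / 2)%:E * \int[K]_z (e z)%:E <= pairing K a b)%E.
Proof.
move=> c0 me e0 eh; rewrite pairingE.
have c20 : 0 <= c / 2 by rewrite divr_ge0// ltW.
have mce : measurable_fun setT (fun z => (c / 2)%:E * (e z)%:E)%E.
  by apply: measurable_funeM; exact/measurable_EFinP.
have ce0 z : (0 <= (c / 2)%:E * (e z)%:E)%E by rewrite -EFinM lee_fin mulr_ge0.
rewrite -ge0_integralZl_EFin//; last 2 first.
- by move=> z _; rewrite lee_fin.
- exact/measurable_EFinP.
(* On the diagonal the pointwise bound reads [c * e z <= 0], so [e] vanishes there and the diagonal
   contributes nothing, whatever its measure. *)
have -> : (\int[K]_z ((c / 2)%:E * (e z)%:E) =
           \int[K]_(z in @offdiag R n) ((c / 2)%:E * (e z)%:E))%E.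
  rewrite [RHS]integral_mkcond; apply: eq_integral => z _.
  rewrite patchE; case: ifPn => // /negP; rewrite inE /offdiag/= => /negP/negPn/eqP zz.
  suff -> : e z = 0 by rewrite mule0.
  apply/eqP; rewrite eq_le e0 andbT -(pmulr_rle0 _ c0) (le_trans (eh z))//.
  by rewrite zz subrr mul0r.
rewrite -bigcup_off_band.
have cv : (\int[K]_(z in off_band k.+2%:R^-1) ((c / 2)%:E * (e z)%:E))%E @[k --> \oo] -->
    (\int[K]_(z in \bigcup_k off_band k.+2%:R^-1) ((c / 2)%:E * (e z)%:E))%E.
  apply: ge0_nondecreasing_set_cvg_integral => //.
  - move=> i j ij; rewrite subsetEset => z; rewrite /off_band/=; apply: le_trans.
    by rewrite lef_pV2 ?posrE// ler_nat.
  - by move=> i; exact: measurable_off_band.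
  - by move=> i; exact: measurable_funTS.
apply: cvge_le cv; apply: nearW => k.
apply: (@le_trans _ _ (2^-1%:E * \int[K]_(z in off_band k.+2%:R^-1) (h z)%:E)%E);
  last by apply: le_S; rewrite ?invr_gt0// invf_lt1// ltr1n.
have mk := measurable_off_band k.+2%:R^-1.
rewrite -ge0_integralZl_EFin//; last 2 first.
- by move=> z _; rewrite lee_fin mono.
- by apply/measurable_EFinP; exact: measurable_funTS.
apply: ge0_le_integral => //.
- exact: measurable_funTS.
- by apply: measurable_funeM; apply/measurable_EFinP; exact: measurable_funTS.
- move=> z _; rewrite -!EFinM lee_fin mulrC mulrA mulrC ler_wpM2l//.
  by rewrite mulrC; exact: eh.
Qed.

End pair.
End kernel.
End pairing.

(** * Pairings with dual powers and the final inequalities *)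

Lemma measurable_signed_power (R : realType) (q : R) :
  measurable_fun [set: R] (signed_power q).
Proof.
apply: measurable_funM => //.
apply: (measurableT_comp (measurable_powR (q - 2))).
exact: normr_measurable.
Qed.

Section main.
Variables (R : realType) (n : nat).
Variable K : {measure set (borel_space2 R n) -> \bar R}.
Hypothesis Kloc : locally_finite_off_diagonal K.
Hypothesis Ksym : symmetric_kernel K.
Hypothesis Kdiag : square_integrable_near_diagonal K.
Hypothesis Ktails : finite_tails K.

(** The symmetrized density is the same for [(u, w)] and [(w, u)]. The first order serves [p >= 2]
    with [q = p], the second [p < 2] with [q = p']. *)
Lemma pairing_dual_power_bound (q : R) (u : 'rV[R]_n -> R) : 2 <= q -> C1_0 u ->
  let w := dual_power q u in
  let c := 4 * (q - 1) / q ^+ 2 in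
  [/\ pairing_exists K u w, ((c / 2)%:E * energy K q u <= pairing K u w)%E,
      pairing_exists K w u & ((c / 2)%:E * energy K q u <= pairing K w u)%E].
Proof.
move=> q2 uC1 w c.
have [r r0 ur] := C1_0_support uC1.
have [M M0 uM] := C1_0_bounded uC1.
have [L L0 uL] := C1_0_lipschitz uC1 (3 * r).
have wE x : w x = signed_power q (u x) by [].
pose N := (q - 1) * M `^ (q - 2).
have N0 : 0 <= N by rewrite mulr_ge0 ?powR_ge0//; lra.
have wr x : w x != 0 -> enorm x < r.
  by rewrite /w /dual_power mulf_eq0 negb_or => /andP[_ /ur].
(* The lemmas on pairs take a single bound for both functions. *)
pose M' := Num.max M (M `^ (q - 1)).
have M'0 : 0 <= M' by rewrite le_max M0.
have uM' x : `|u x| <= M' by rewrite le_max uM.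
have wM' x : `|w x| <= M'.
  rewrite le_max wE norm_signed_power//; apply/orP; right.
  by apply: ge0_ler_powR; rewrite ?nnegrE//; lra.
have lip x y : `|x| <= 3 * r -> `|y| <= 3 * r ->
    `|(u x - u y) * (w x - w y)| <= N * L ^+ 2 * enorm (x - y) ^+ 2.
  move=> xr yr; rewrite normrM !wE.
  apply: (@le_trans _ _ (`|u x - u y| * (N * `|u x - u y|))).
    by rewrite ler_wpM2l// signed_power_lipschitz.
  rewrite mulrCA -expr2 -mulrA ler_wpM2l// -exprMn lerXn2r ?nnegrE//.
    by rewrite mulr_ge0 ?enorm_ge0.
  exact: uL.
have c0 : 0 < c by rewrite /c divr_gt0 ?exprn_gt0//; lra.
have NL0 : 0 <= N * L ^+ 2 by rewrite mulr_ge0 ?sqr_ge0.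
pose e (z : borel_space2 R n) := (`|u z.2| `^ (q / 2) - `|u z.1| `^ (q / 2)) ^+ 2.
have e0 z : 0 <= e z by exact: sqr_ge0.
have sv x y : c * e (x, y) <= (u x - u y) * (w x - w y).
  by rewrite /e/= -sqrrN opprB; exact: stroock_varopoulos.
have mono x y : 0 <= (u x - u y) * (w x - w y).
  by apply: le_trans (sv x y); rewrite mulr_ge0 ?e0// ltW.
have mu := continuous_measurable_borel (C1_0_continuous uC1).
have mw : measurable_fun [set: borel_space R n] (w : borel_space R n -> R).
  exact: (measurableT_comp (measurable_signed_power q) mu).
have me : measurable_fun [set: borel_space2 R n] e.
  have mup : measurable_fun [set: borel_space R n] (fun x : borel_space R n => `|u x| `^ (q / 2)).
    apply: (measurableT_comp (measurable_powR (q / 2))).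
    by apply: (measurableT_comp _ mu); exact: normr_measurable.
  apply: measurable_funX; apply: measurable_funB.
    exact: (measurableT_comp mup (@measurable_borel_snd R n)).
  exact: (measurableT_comp mup (@measurable_borel_fst R n)).
have lip' x y : `|x| <= 3 * r -> `|y| <= 3 * r ->
    `|(w x - w y) * (u x - u y)| <= N * L ^+ 2 * enorm (x - y) ^+ 2.
  by move=> xr yr; rewrite [X in `|X|]mulrC; exact: lip.
have mono' x y : 0 <= (w x - w y) * (u x - u y) by rewrite mulrC.
rewrite /energy.
split.
- exact: (pairing_exists_of_monotone Kloc Ksym Kdiag Ktails r0 mu mw ur wr M'0 uM' wM' NL0 lip mono).
- apply: (pairing_ge_energy Kloc Ksym Kdiag Ktails r0 mu mw wr M'0 uM' wM' mono c0 me e0).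
  by move=> [x y]; exact: sv.
- exact: (pairing_exists_of_monotone Kloc Ksym Kdiag Ktails r0 mw mu wr ur M'0 wM' uM' NL0 lip' mono').
- apply: (pairing_ge_energy Kloc Ksym Kdiag Ktails r0 mw mu ur M'0 wM' uM' mono' c0 me e0).
  by move=> [x y]; rewrite [leRHS]mulrC; exact: sv.
Qed.

End main.

Unset Implicit Arguments.

Theorem theorem6p1 (R : realType) (n : nat) (hn : (0 < n)%N)
    (p : R) (hp : 1 < p)
    (K : {measure set (borel_space2 R n) -> \bar R})
    (hloc : locally_finite_off_diagonal K)
    (hsym : symmetric_kernel K)
    (hdiag : square_integrable_near_diagonal K)
    (htails : finite_tails K)
    (hT : forall u : 'rV[R]_n -> R, C1_0 u -> T_exists K u) :
  let p' := conj_exponent p in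
  Lp_positive K p /\
  (forall u : 'rV[R]_n -> R, C1_0 u ->
     (2 <= p ->
        pairing_exists K u (dual_power p u) /\
        ((2 / (p * p'))%:E * energy K p u <= pairing K u (dual_power p u))%E) /\
     (p < 2 ->
        pairing_exists K (dual_power p' u) u /\
        ((2 / (p * p'))%:E * energy K p' u <= pairing K (dual_power p' u) u)%E)).
Proof.
move=> p'.
have main q u := @pairing_dual_power_bound R n K hloc hsym hdiag htails q u.
have p'E : p' = p / (p - 1) by [].
have p1 : 0 < p - 1 by lra.
(* Since p p' = p^2/(p-1), the constant is half the Stroock-Varopoulos one for [p]; being symmetric
   in [p] and [p'], it also serves [q = p']. *)
have c1 : 2 / (p * p') = 4 * (p - 1) / p ^+ 2 / 2.
  by rewrite p'E; field; apply/andP; split; lra.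
have c2 : 2 / (p * p') = 4 * (p' - 1) / p' ^+ 2 / 2.
  by rewrite p'E; field; apply/andP; split; lra.
have p'2 : p < 2 -> 2 <= p' by move=> p2; rewrite p'E ler_pdivlMr//; lra.
have H u : C1_0 u ->
     (2 <= p ->
        pairing_exists K u (dual_power p u) /\
        ((2 / (p * p'))%:E * energy K p u <= pairing K u (dual_power p u))%E) /\
     (p < 2 ->
        pairing_exists K (dual_power p' u) u /\
        ((2 / (p * p'))%:E * energy K p' u <= pairing K (dual_power p' u) u)%E).
  move=> uC1; split=> [p2|/p'2 p2].
    by rewrite c1; have [] := main p u p2 uC1.
  by rewrite c2; have [] := main p' u p2 uC1.
split=> // u uC1; have [H1 H2] := H u uC1.
(* Positivity of [T] follows from the two bounds, whose lower sides are nonnegative. *)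
have E0 q : (0 <= (2 / (p * p'))%:E * energy K q u)%E.
  apply: mule_ge0.
    by rewrite lee_fin p'E divr_ge0// mulr_ge0 ?divr_ge0//; lra.
  by apply: integral_ge0 => z _; rewrite lee_fin sqr_ge0.
split=> [/H1[_ /(le_trans (E0 p))]//|/andP[_ /H2[_ /(le_trans (E0 p'))]]//].
Qed.
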